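(* Let $m\in\mathbb{N}$ and $c\in(0,1)$, and assume that $cm\in\mathbb{N}$. Then $\mathbb{R}_m\subset\mathcal{H}(c)$.
   Context: $\mathbb{N}$ denotes the positive integers and $\langle x\rangle=x-[x]$ the fractional part of $x\in\mathbb{R}$. The symbol $\subset$ denotes (not necessarily strict) inclusion. For $0<c<1$, $$\mathcal{H}(c)=\Big\{\alpha\in\mathbb{R}\;:\;\mathrm{card}\{1\le k\le n : \langle k\alpha\rangle<c\}\ge cn\ \text{ for all } n\in\mathbb{N}\Big\}.$$ A continued fraction expansion $[a_0,a_1,a_2,\ldots]_\downarrow$ (simple continued fraction $a_0+\frac{1}{a_1+\frac{1}{a_2+\cdots}}$) has $a_0\in\mathbb{Z}$ and $a_k\in\mathbb{N}$ for $k\ge1$; its length is its number of entries. Every irrational has a unique (infinite) expansion, and every rational has exactly two finite expansions, of consecutive lengths (the last entry $1$ is allowed). The odd continued fraction expansion of $\alpha$ is the unique one with length in $\{\infty,1,3,5,\ldots\}$; its entries are denoted $a_k(\alpha)$. It has length $1$ if and only if $\alpha\in\mathbb{Z}$. Define $\phi:\mathbb{R}\to\mathbb{R}$ by $\phi(\alpha)=\frac{1}{\langle\alpha\rangle}$ if $\alpha\notin\mathbb{Z}$ and $\phi(\alpha)=0$ if $\alpha\in\mathbb{Z}$. For $m\in\mathbb{N}$, let $$\mathbb{R}(m)=\{\alpha\in\mathbb{R}\setminus\mathbb{Z} : a_1(\alpha)\in m\mathbb{N}\}\cup\mathbb{Z},\qquad \mathbb{R}_m=\{\alpha\in\mathbb{R}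 : \phi^{2k}(\alpha)\in\mathbb{R}(m)\text{ for all } k\ge0\},$$ where $\phi^{2k}$ is the $2k$-fold iterate of $\phi$. *)

(* Defs.v *)
(* MathComp / MathComp-Analysis *)
From mathcomp Require Import all_boot all_order all_algebra.
From mathcomp Require Import all_classical all_reals all_analysis.

Set Implicit Arguments.
Unset Strict Implicit.
Unset Printing Implicit Defensive.
Import Order.TTheory GRing.Theory Num.Theory numFieldNormedType.Exports.

Local Open Scope classical_set_scope.
Local Open Scope ring_scope.

Definition fracpart {R : realType} (x : R) : R := x - (Num.floor x)%:~R.

Definition calH {R : realType} (c : R) : set R :=
  [set alpha | forall n : nat, (0 < n)%N ->
     c * n%:R <= (count (fun k : nat => fracpart (k%:R * alpha) < c) (iota 1 n))%:R].

Inductive cfrac : Type :=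
| CFfinite of seq int
| CFinfinite of (nat -> int).

(* [None] when there is no entry of index [k]. *)
Definition cf_entry (e : cfrac) (k : nat) : option int :=
  match e with
  | CFfinite s => onth s k
  | CFinfinite a => Some (a k)
  end.

Definition cf_wf (e : cfrac) : Prop :=
  cf_entry e 0 <> None /\
  forall (k : nat) (a : int), (0 < k)%N -> cf_entry e k = Some a -> 0 < a.

(* [0^-1 = 0] makes the value of a one-entry list that entry; in a well-formed
   expansion no other inverse of 0 occurs. *)
Fixpoint cf_value {R : realType} (s : seq int) : R :=
  if s is a :: s' then a%:~R + (cf_value s')^-1 else 0.

Definition cf_represents {R : realType} (e : cfrac) (alpha : R) : Prop :=
  match e with
  | CFfinite s => cf_value s = alpha
  | CFinfinite a => cf_value (mkseq a n.+1) @[n --> \oo] --> alpha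
  end.

Definition cf_odd_length (e : cfrac) : Prop :=
  match e with
  | CFfinite s => odd (size s)
  | CFinfinite _ => True
  end.

Definition is_odd_cf {R : realType} (alpha : R) (e : cfrac) : Prop :=
  [/\ cf_wf e, cf_odd_length e & cf_represents e alpha].

(* The odd expansion of [alpha] has an entry of index [k], and it is [a].  The
   expansion exists and is unique, so this is the graph of the partial function
   (k, alpha) |-> a_k(alpha). *)
Definition odd_cf_entry {R : realType} (k : nat) (alpha : R) (a : int) : Prop :=
  exists2 e : cfrac, is_odd_cf alpha e & cf_entry e k = Some a.

Definition phi {R : realType} (alpha : R) : R :=
  if alpha \is a Num.int then 0 else (fracpart alpha)^-1.

(* R(m) *)
Definition Rparen {R : realType} (m : nat) : set R :=
  [set alpha | alpha \isn't a Num.int /\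
     exists2 j : nat, (0 < j)%N & odd_cf_entry 1 alpha (m * j)%N%:Z]
  `|` [set alpha | alpha \is a Num.int].

(* R_m *)
Definition Rsub {R : realType} (m : nat) : set R :=
  [set alpha | forall k : nat, Rparen m (iter (2 * k) phi alpha)].

(* Main.v *)
Require Import Defs.
From mathcomp Require Import all_boot all_order all_algebra.
From mathcomp Require Import all_classical all_reals all_analysis.
From mathcomp Require Import ring lra zify.

Set Implicit Arguments.
Unset Strict Implicit.
Unset Printing Implicit Defensive.
Import Order.TTheory GRing.Theory Num.Theory numFieldNormedType.Exports.

(** Let [excess x n] be the number of [k < n] with fractional part of [k x]
    below [c], minus [c n].  Since [k = 0] always counts, membership in
    [calH c] says that [excess alpha n] is at least [1 - c] for all [n > 0].

    Let [theta] be the inverse of the fractional part of [alpha].  The points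
    [k / theta] climb the real line by steps shorter than 1, and those lying
    in [[Q, Q + 1)] are the [k] with
    [ceil (Q theta) <= k < ceil ((Q + 1) theta)].  They first visit
    [[Q, Q + c)], where the excess grows, and then [[Q + c, Q + 1)], where it
    drops (lemmas [excess_block_up] and [excess_block_down]); so within such a
    block the excess is least at one of the two ends.

    At the ends the excess is invariant under renormalization.  If
    [theta = a + gamma] with [c a] an integer, then the block of [Q] has
    [ceil ((Q + c) theta) - ceil (Q theta)
    = c a + ceil ((Q + c) gamma) - ceil (Q gamma)] hits among
    [a + ceil ((Q + 1) gamma) - ceil (Q gamma)] points, and the contributions
    of [a] to the excess cancel.  Hence [excess (1 / theta)] at
    [ceil (Q theta)] equals [excess (1 / gamma)] at [ceil (Q gamma)]
    ([excess_renorm]).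

    The membership of [alpha] in [Rsub m] provides exactly this situation:
    [theta = m j + gamma] with [0 < gamma <= 1] and with [1 / gamma] again in
    [Rsub m], because it is the second iterate of [phi], or the integer 1 when
    the odd expansion stops at [a0; a1, 1] ([Rsub_step]).  Since
    [1 / theta < 1 <= 1 / gamma], the index [ceil (Q gamma)] is smaller than
    the original one, and a strong induction on [n], for all [alpha] at once,
    concludes; it bottoms out at integers and in the block [Q = 0], where the
    excess starts by growing from 0. *)

Local Open Scope classical_set_scope.
Local Open Scope ring_scope.

(** * Ceilings and fractional parts *)

Section Ceil.
Variable R : realType.
Implicit Types x y : R.

Definition ceiln y : nat := `|Num.ceil y|%N.

Lemma ltn_ceiln y k : 0 <= y -> (k < ceiln y)%N = (k%:R < y).
Proof.
move=> y0; rewrite -ltz_nat /ceiln gez0_abs ?ceil_gt_int//.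
by rewrite ceil_ge0 (lt_le_trans _ y0)// ltrN10.
Qed.

Lemma leq_ceiln y k : 0 <= y -> (ceiln y <= k)%N = (y <= k%:R).
Proof. by move=> y0; rewrite leqNgt ltn_ceiln// -leNgt. Qed.

Lemma ceilnDnat a y : 0 <= y -> ceiln (a%:R + y) = (a + ceiln y)%N.
Proof.
move=> y0; rewrite /ceiln ceilDzr ?natr_int// -[a%:R]/(a%:Z%:~R) intrKceil.
have : 0 <= Num.ceil y by rewrite ceil_ge0 (lt_le_trans _ y0)// ltrN10.
by case: (Num.ceil y) => // k _.
Qed.

Lemma ceiln_le x y : 0 <= x -> x <= y -> (ceiln x <= ceiln y)%N.
Proof.
move=> x0 xy; have y0 := le_trans x0 xy.
by rewrite leq_ceiln// (le_trans xy)// -leq_ceiln.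
Qed.

Lemma fracpartE x (z : int) : z%:~R <= x < (z + 1)%:~R -> fracpart x = x - z%:~R.
Proof. by move=> /floor_def xz; rewrite /fracpart xz. Qed.

Lemma fracpart_itv x : 0 <= fracpart x < 1.
Proof.
have := floor_itv x; rewrite /fracpart intrD => /andP[? ?].
by apply/andP; split; lra.
Qed.

Lemma fracpartDint x (z : int) : fracpart (z%:~R + x) = fracpart x.
Proof.
rewrite /fracpart floorDzr ?intr_int// intrKfloor.
by rewrite intrD opprD addrACA subrr add0r.
Qed.

End Ceil.

(** * The excess of visits to [[0, c)] *)

Section Excess.
Variables (R : realType) (c : R).
Hypotheses (c0 : 0 < c) (c1 : c < 1).
Implicit Types x theta gamma : R.

(** The index [k = 0] is included, and always a hit: it makes the block of
    [Q = 0] look like all others. *)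
Definition hits x n : nat := count (fun k : nat => fracpart (k%:R * x) < c) (iota 0 n).

Definition excess x n : R := (hits x n)%:R - c * n%:R.

Lemma hitsS x n : hits x n.+1 = (hits x n + (fracpart (n%:R * x) < c)%R)%N.
Proof. by rewrite /hits -addn1 iotaD count_cat /= addn0 add0n. Qed.

Lemma hits_fracpart x n : hits (fracpart x) n = hits x n.
Proof.
apply: eq_count => k /=; congr (_ < c).
have -> : k%:R * x = (k%:Z * Num.floor x)%:~R + k%:R * fracpart x.
  by rewrite intrM mulrBr addrC subrK.
by rewrite fracpartDint.
Qed.

(** For [k] in the block of [Q] the integer part of [k / theta] is [Q], so that
    [k] is a hit exactly when [k < (Q + c) theta]. *)
Lemma hits_block theta (Q N : nat) : 0 < theta ->
  (ceiln (Q%:R * theta) <= N <= ceiln (Q.+1%:R * theta))%N ->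
  hits theta^-1 N = (hits theta^-1 (ceiln (Q%:R * theta)) +
     (minn N (ceiln ((Q%:R + c) * theta)) - ceiln (Q%:R * theta)))%N.
Proof.
move=> t0 /andP[aN]; rewrite -(subnKC aN).
set A := ceiln (Q%:R * theta).
have tge0 (y : R) : 0 <= y -> 0 <= y * theta by move=> y0; rewrite mulr_ge0// ltW.
have Qc0 : 0 <= Q%:R + c :> R by rewrite addr_ge0// ltW.
have AB : (A <= ceiln ((Q%:R + c) * theta))%N.
  by rewrite ceiln_le ?tge0// ler_pM2r// lerDl ltW.
elim: (N - A)%N => [|d IH] dN; first by rewrite addn0 (minn_idPl AB) subnn addn0.
rewrite addnS hitsS IH; last by rewrite (leq_trans _ dN)// addnS.
set k := (A + d)%N.
have -> : (fracpart (k%:R / theta) < c) = (k < ceiln ((Q%:R + c) * theta))%N.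
  rewrite ltn_ceiln ?tge0// (fracpartE (z := Q)).
    by rewrite ltrBlDl -pmulrn ltr_pdivrMr.
  rewrite -pmulrn -[(Q + 1)%:~R]/((Q + 1)%:R) addn1.
  rewrite ler_pdivlMr// ltr_pdivrMr// -ltn_ceiln ?tge0//.
  by rewrite -leq_ceiln ?tge0// -/A leq_addr -addnS.
have : (A <= k)%N by exact: leq_addr.
move: (ceiln ((Q%:R + c) * theta)) AB (hits _ A) k => B AB h k Ak.
by case: (ltnP k) => kB /=; lia.
Qed.

Lemma excess_block_up theta (Q N : nat) : 0 < theta ->
  (ceiln (Q%:R * theta) <= N <= ceiln (Q.+1%:R * theta))%N ->
  (N <= ceiln ((Q%:R + c) * theta))%N ->
  excess theta^-1 N = excess theta^-1 (ceiln (Q%:R * theta)) +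
    (1 - c) * (N%:R - (ceiln (Q%:R * theta))%:R).
Proof.
move=> t0 QN Nc; rewrite /excess (hits_block t0 QN) (minn_idPl Nc).
have /andP[AN _] := QN; rewrite natrD natrB//; ring.
Qed.

Lemma ceiln_mid theta (Q : nat) : 0 < theta ->
  (ceiln (Q%:R * theta) <= ceiln ((Q%:R + c) * theta) <= ceiln (Q.+1%:R * theta))%N.
Proof.
move=> t0; have Qc : Q%:R <= Q%:R + c by rewrite lerDl ltW.
rewrite !ceiln_le ?ler_pM2r ?mulr_ge0 ?(le_trans _ Qc) ?(ltW t0)//.
by rewrite -natr1 lerD2l ltW.
Qed.

Lemma excess_block_down theta (Q N : nat) : 0 < theta ->
  (ceiln ((Q%:R + c) * theta) <= N <= ceiln (Q.+1%:R * theta))%N ->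
  excess theta^-1 (ceiln (Q.+1%:R * theta)) =
  excess theta^-1 N - c * ((ceiln (Q.+1%:R * theta))%:R - N%:R).
Proof.
move=> t0 /andP[cN NQ]; have /andP[Qc cQ] := ceiln_mid Q t0.
rewrite /excess (hits_block t0 (Q := Q) (N := N)) ?(leq_trans Qc cN)//.
rewrite (hits_block t0 (Q := Q) (N := ceiln (Q.+1%:R * theta))) ?(leq_trans Qc cQ) ?leqnn//.
rewrite (minn_idPr cN) (minn_idPr cQ); ring.
Qed.

Lemma excess_block theta (Q : nat) : 0 < theta ->
  excess theta^-1 (ceiln (Q.+1%:R * theta)) =
  excess theta^-1 (ceiln (Q%:R * theta)) +
  ((ceiln ((Q%:R + c) * theta))%:R - (ceiln (Q%:R * theta))%:R) -
  c * ((ceiln (Q.+1%:R * theta))%:R - (ceiln (Q%:R * theta))%:R).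
Proof.
move=> t0; have mid := ceiln_mid Q t0; have /andP[Qc cQ] := mid.
rewrite (@excess_block_down _ Q (ceiln ((Q%:R + c) * theta)))// ?cQ ?leqnn//.
by rewrite (excess_block_up t0 mid)//; ring.
Qed.

(** Adding the integer [a] to [gamma] shifts the three ceilings bounding and
    splitting the block of [Q] by [Q a], [Q a + p] and [Q a + a]; the excess
    gained over the block changes by [p - c a = 0]. *)
Lemma excess_renorm theta gamma (a p Q : nat) : 0 < gamma ->
  theta = a%:R + gamma -> c * a%:R = p%:R ->
  excess theta^-1 (ceiln (Q%:R * theta)) = excess gamma^-1 (ceiln (Q%:R * gamma)).
Proof.
move=> g0 tE cap; have t0 : 0 < theta by rewrite tE ltr_wpDl.
have E (k : nat) : ceiln (k%:R * theta) = (k * a + ceiln (k%:R * gamma))%N.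
  by rewrite tE mulrDr -natrM ceilnDnat// mulr_ge0// ltW.
elim: Q => [|Q IH]; first by rewrite !mul0r /ceiln ceil0 /excess.
have Ec : ceiln ((Q%:R + c) * theta) = (Q * a + p + ceiln ((Q%:R + c) * gamma))%N.
  rewrite -ceilnDnat ?mulr_ge0 ?addr_ge0 ?(ltW c0) ?(ltW g0)//.
  by rewrite tE natrD natrM -cap; congr ceiln; ring.
rewrite !excess_block// IH Ec 2!E !natrD !natrM -cap -natr1; ring.
Qed.

End Excess.

(** * One double step of the odd continued fraction *)

Section OddExpansion.
Variable R : realType.
Implicit Types alpha : R.

(** The value 0 is that of the empty list; its inverse is 0 too, which is the
    right tail of an expansion that has just ended. *)
Lemma cf_value_eq0_or_ge1 (s : seq int) : (forall k a, onth s k = Some a -> 0 < a) ->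
  cf_value s = 0 :> R \/ 1 <= cf_value s :> R.
Proof.
elim: s => [|a s IH] s0 /=; first by left.
right; have a1 : 1 <= a%:~R :> R by rewrite ler1z; have := s0 0%N a erefl; lia.
suff : 0 <= (cf_value s)^-1 :> R by lra.
rewrite invr_ge0; have [|->//|/(le_trans ler01)//] := IH.
by move=> k b kb; apply: (s0 k.+1).
Qed.

(** The bounds are closed, hence pass to the limit of an infinite expansion,
    and their form [(a1 + 1)^-1], [(a1 + u)^-1] with a fixed [u > 0] still
    determines the next remainder to be in the half-open interval [(0, 1]]. *)
Lemma cf_value_bounds (a0 a1 a2 : int) (s : seq int) :
  (forall k a, onth [:: a1, a2 & s] k = Some a -> 0 < a) ->
  (a1%:~R + 1)^-1 <= (cf_value [:: a0, a1, a2 & s] : R) - a0%:~R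
                  <= (a1%:~R + (a2%:~R + 1)^-1)^-1.
Proof.
move=> pos /=; rewrite [a0%:~R + _]addrC addrK.
have a1_ge1 : 1 <= a1%:~R :> R by rewrite ler1z; have := pos 0%N a1 erefl; lia.
have a2_ge1 : 1 <= a2%:~R :> R by rewrite ler1z; have := pos 1%N a2 erefl; lia.
have /andP[v0 v1] : 0 <= (cf_value s : R)^-1 <= 1.
  have [|->|v1] := @cf_value_eq0_or_ge1 s.
  - by move=> k b kb; apply: (pos k.+2).
  - by rewrite invr0 lexx ler01.
  - by rewrite invr_ge0 (le_trans ler01 v1) invf_le1 ?(lt_le_trans ltr01 v1).
set v := (cf_value s)^-1 in v0 v1 *.
have u0 : 0 < (a2%:~R + 1)^-1 :> R by rewrite invr_gt0; lra.
have u : (a2%:~R + 1)^-1 <= (a2%:~R + v)^-1 by rewrite lef_pV2 ?posrE; lra.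
have w : (a2%:~R + v)^-1 <= 1 by rewrite invf_le1; lra.
by rewrite !lef_pV2 ?posrE; lra.
Qed.

(** An expansion of odd length with an entry [a1] has an entry [a2] as well.
    The value [gamma = 1] occurs for the tail [a2 = 1]: there [a1] is one less
    than the integer part of the inverse of the fractional part. *)
Lemma odd_cf_entry1_step alpha (a1 : int) : alpha \isn't a Num.int ->
  odd_cf_entry 1 alpha a1 ->
  exists2 gamma, 0 < gamma <= 1 & (fracpart alpha)^-1 = a1%:~R + gamma.
Proof.
move=> alphaNint [e [[e0 epos] eodd erep] e1].
have a1_gt0 : 0 < a1 by apply: (epos 1%N).
have [a0 [a2 [a2_gt0]]] : exists a0 a2 : int, 0 < a2 /\
    (a1%:~R + 1)^-1 <= alpha - a0%:~R <= (a1%:~R + (a2%:~R + 1)^-1)^-1.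
  case: e e0 epos eodd erep e1 => [[|a0 [|b [|a2 s]]]|f] //= _ epos _ erep [e1].
    exists a0, a2; split; first exact: (epos 2%N).
    rewrite -erep -e1; apply: cf_value_bounds => k a ka.
    exact: (epos k.+1).
  exists (f 0%N), (f 2%N); split; first exact: (epos 2%N).
  have bnd : \forall n \near \oo, (a1%:~R + 1)^-1 <= (cf_value (mkseq f n.+1) : R) - (f 0%N)%:~R
      <= (a1%:~R + ((f 2%N)%:~R + 1)^-1)^-1.
    exists 2%N => // -[|[|n]] //= _; rewrite -e1; apply: cf_value_bounds => k a ka.
    have kn : (k.+1 < n.+3)%N by rewrite -(size_mkseq f n.+3) -onthTE /= ka.
    apply: (epos k.+1) => //; congr Some.
    by rewrite -(nth_mkseq 0 f kn); apply: (@onth_nth _ _ _ (mkseq f n.+3)).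
  apply/andP; split.
    by rewrite lerBrDr; apply: (cvgr_to_ge erep); near=> n; rewrite -lerBrDr;
       near: n; apply: filterS bnd => n /andP[].
  by rewrite lerBlDr; apply: (cvgr_to_le erep); near=> n; rewrite -lerBlDr;
       near: n; apply: filterS bnd => n /andP[].
have a1_ge1 : 1 <= a1%:~R :> R by rewrite ler1z; lia.
have a2_ge1 : 1 <= a2%:~R :> R by rewrite ler1z; lia.
have u0 : 0 < (a2%:~R + 1)^-1 :> R by rewrite invr_gt0; lra.
move=> /andP[lo hi].
have r0 : 0 < alpha - a0%:~R by apply: lt_le_trans lo; rewrite invr_gt0; lra.
have r1 : alpha - a0%:~R < 1.
  by apply: le_lt_trans hi _; rewrite invf_lt1; lra.
rewrite (@fracpartE _ alpha a0); last by rewrite intrD; lra.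
exists ((alpha - a0%:~R)^-1 - a1%:~R); last by ring.
have lo' : (alpha - a0%:~R)^-1 <= a1%:~R + 1.
  by rewrite -[leRHS]invrK lef_pV2 ?posrE// invr_gt0; lra.
have hi' : a1%:~R + (a2%:~R + 1)^-1 <= (alpha - a0%:~R)^-1.
  by rewrite -[leLHS]invrK lef_pV2 ?posrE// invr_gt0; lra.
lra.
Unshelve. all: by end_near.
Qed.

Lemma Rsub_int (m : nat) alpha : alpha \is a Num.int -> Rsub m alpha.
Proof.
move=> aint k; right => /=; elim: k => [|k _]; first by rewrite muln0.
elim: (2 * _)%N => //= n IH.
by rewrite /phi IH.
Qed.

Lemma Rsub_phi2 (m : nat) alpha : Rsub m alpha -> Rsub m (phi (phi alpha)).
Proof. by move=> ma k; have := ma k.+1; rewrite mulnS 2!iterSr. Qed.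

(** When [gamma < 1], it is the fractional part of [phi alpha], hence
    [gamma^-1 = phi (phi alpha)]; when [gamma = 1], its inverse is an integer. *)
Lemma Rsub_step (m : nat) alpha : (0 < m)%N -> Rsub m alpha ->
  alpha \isn't a Num.int ->
  exists (j : nat) (gamma : R), [/\ 0 < gamma <= 1,
    (fracpart alpha)^-1 = (m * j)%:R + gamma & Rsub m gamma^-1].
Proof.
move=> m0 ma aNint; have := ma 0%N; rewrite muln0 /= => -[|/(negP aNint)//].
move=> [_ [j j0 /(odd_cf_entry1_step aNint) [gamma /andP[g0 g1] E]]].
exists j, gamma; split; rewrite ?g0//.
move: g1; rewrite le_eqVlt => /predU1P[->|g1].
  by rewrite invr1; apply: Rsub_int; rewrite rpred1.
have Efrac : fracpart (phi alpha) = gamma.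
  rewrite /phi (negPf aNint) E (fracpartE (z := (m * j)%N)); first by rewrite addrC addKr.
  by rewrite intrD; lra.
have := Rsub_phi2 ma; rewrite {1}/phi Efrac ifN//.
by rewrite intrEfloor; apply/eqP => F; move: Efrac; rewrite /fracpart F; lra.
Qed.

End OddExpansion.

(** * The descent *)

Lemma Rsub_excess (R : realType) (m p : nat) (c : R) : (0 < m)%N ->
  0 < c -> c < 1 -> c * m%:R = p%:R ->
  forall (n : nat) (alpha : R), (0 < n)%N -> Rsub m alpha -> 1 - c <= excess c alpha n.
Proof.
move=> m0 c0 c1 cm; elim/ltn_ind => n IH alpha n0 ma.
have grow (d : nat) : (0 < d)%N -> 1 - c <= (1 - c) * d%:R.
  by move=> d0; rewrite ler_peMr ?subr_ge0 ?(ltW c1)// ler1n.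
(* At an integer every index is a hit. *)
have [aint|aNint] := boolP (alpha \is a Num.int).
  have -> : excess c alpha n = (1 - c) * n%:R.
    rewrite mulrBl mul1r /excess; congr (_%:R - _).
    rewrite -[RHS](size_iota 0); apply/eqP; rewrite -all_count.
    apply/allP => k _ /=; have : k%:R * alpha \is a Num.int by rewrite rpredM ?natr_int.
    by rewrite intrEfloor => /eqP; rewrite /fracpart => ->; rewrite subrr.
  exact: grow.
have [j [gamma [/andP[g0 g1] E mg]]] := Rsub_step m0 ma aNint.
set theta : R := (fracpart alpha)^-1 in E.
have /andP[f0 f1] := fracpart_itv alpha.
have t1 : 1 < theta.
  rewrite /theta invf_gt1// lt_neqAle f0 andbT eq_sym subr_eq0 eq_sym.
  by rewrite -intrEfloor.
have t0 : 0 < theta by lra.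
have -> : excess c alpha n = excess c theta^-1 n.
  by rewrite /excess /theta invrK hits_fracpart.
have renorm (Q : nat) : excess c theta^-1 (ceiln (Q%:R * theta)) =
    excess c gamma^-1 (ceiln (Q%:R * gamma)).
  by apply: (excess_renorm c0 c1 (a := m * j) (p := p * j)) => //; rewrite !natrM mulrA cm.
have endpoint (Q : nat) : (0 < Q)%N -> (Q < n)%N ->
    1 - c <= excess c theta^-1 (ceiln (Q%:R * theta)).
  move=> Q0 Qn; rewrite renorm; apply: IH => //.
    apply: leq_ltn_trans Qn; rewrite leq_ceiln ?mulr_ge0 ?(ltW g0)//.
    by rewrite ler_piMr.
  by rewrite ltn_ceiln ?mulr_gt0 ?ltr0n// mulr_ge0// ltW.
(* The last index counted by [excess alpha n] is [n.-1]: it lies in block [Q]. *)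
pose Q := Num.truncn (n.-1%:R / theta).
have /andP[Qle Qgt] : Q%:R <= n.-1%:R / theta < Q.+1%:R.
  by apply: truncn_itv; rewrite divr_ge0// ltW.
have QN : (ceiln (Q%:R * theta) <= n <= ceiln (Q.+1%:R * theta))%N.
  apply/andP; split.
    rewrite (leq_trans _ (leq_pred n))// leq_ceiln ?mulr_ge0 ?(ltW t0)//.
    by rewrite -ler_pdivlMr.
  by rewrite -[X in (X <= _)%N](prednK n0) ltn_ceiln ?mulr_ge0 ?(ltW t0)// -ltr_pdivrMr.
have Qn : (Q <= n.-1)%N.
  rewrite -(ler_nat R) (le_trans Qle)// ler_pdivrMr// ler_peMr// ltW//.
have [nmid|midn] := leqP n (ceiln ((Q%:R + c) * theta)).
  rewrite (excess_block_up c0 c1 t0 QN nmid).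
  (* The left end of the block of 0 is the index 0, where the excess is only 0:
     there the growth itself gives the bound. *)
  case: (posnP Q) QN => [->|Q0] QN.
    by rewrite mul0r /ceiln ceil0 /excess /hits/= mulr0 !subr0 add0r grow.
  apply: le_trans (endpoint Q Q0 _) _; first by lia.
  rewrite lerDl mulr_ge0 ?subr_ge0 ?(ltW c1)// ler_nat.
  by case/andP: QN.
have mid0 : (0 < ceiln ((Q%:R + c) * theta))%N.
  have Qc0 : 0 < Q%:R + c by rewrite ltr_wpDl.
  by rewrite ltn_ceiln ?mulr_gt0// ltW// mulr_gt0.
have n1 : 0 < n.-1%:R :> R by rewrite ltr0n; lia.
have Qn' : (Q < n.-1)%N.
  by rewrite -(ltr_nat R) (le_lt_trans Qle)// ltr_pdivrMr// ltr_pMr.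
apply: le_trans (endpoint Q.+1 isT _) _; first by lia.
have dn : (ceiln ((Q%:R + c) * theta) <= n <= ceiln (Q.+1%:R * theta))%N.
  by rewrite (ltnW midn); case/andP: QN.
rewrite (excess_block_down c0 c1 t0 dn) lerBlDr lerDl mulr_ge0 ?(ltW c0)//.
by rewrite subr_ge0 ler_nat; case/andP: QN.
Qed.

Theorem theorem5 (R : realType) (m : nat) (c : R)
    (hm : (0 < m)%N) (hc0 : 0 < c) (hc1 : c < 1)
    (hcm : exists2 p : nat, (0 < p)%N & c * m%:R = p%:R) :
  (Rsub m : set R) `<=` calH c.
Proof.
move=> alpha ma n n0; have [p _ cm] := hcm.
have := Rsub_excess hm hc0 hc1 cm (n := n.+1) isT ma.
rewrite /excess /hits /= mul0r.
have -> : fracpart (0 : R) = 0 by rewrite /fracpart floor0 subr0.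
rewrite hc0 natrD -natr1 /=; lra.
Qed.
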